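(* For each $\ell\in\{0,1,\dots,109\}$ let $f_\ell:\mathbb{Z}_{11}\to\mathbb{Z}_{11}$ be the $11$-adic interpolation of $m\mapsto T_{\ell+110m}$. Then the Tribonacci sequence has exactly $10$ $11$-adic zeros, i.e. there are exactly ten pairs $(\ell,z)$ with $\ell\in\{0,1,\dots,109\}$, $z\in\mathbb{Z}_{11}$ and $f_\ell(z)=0$; there is exactly one such pair for each $\ell\in\{0,8,14,35,37,42,61,93,106,109\}$. Six of them arise from the integer and rational zeros of the Tribonacci sequence: for $(\ell,\zeta)\in\{(0,0),(109,-1),(106,-4),(93,-17),(37,1/3),(35,-5/3)\}$, the zero $z$ of $f_\ell$ satisfies $\ell+110z=\zeta$. The other four, those with $\ell\in\{8,14,42,61\}$, do not arise in this way, i.e. $\ell+110z\notin\{-17,-4,-5/3,-1,0,1/3\}$. Moreover, for $n\in\mathbb{Z}$: - if $n\equiv\ell\pmod{110}$ for one of the six pairs $(\ell,\zeta)$ listed above, then $\nu_{11}(T_n)=\nu_{11}(n+c)+1$, where $c=-\zeta$; - if $n \bmod 110\notin\{0,8,14,35,37,42,61,93,106,109\}$, then $\nu_{11}(T_n)=0$.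
   Context: $(T_n)_{n\in\mathbb{Z}}$ is the Tribonacci sequence: $T_0=0$, $T_1=T_2=1$ and $T_{n+3}=T_{n+2}+T_{n+1}+T_n$ for all $n\in\mathbb{Z}$. $\mathbb{Z}_{11}$ is the ring of $11$-adic integers and $\nu_{11}$ the $11$-adic valuation on $\mathbb{Q}$ (and $\mathbb{Q}_{11}$), with $\nu_{11}(0):=\infty$. The period of the Tribonacci sequence modulo $11$ is $110$. For each $\ell\in\{0,\dots,109\}$, the $11$-adic interpolation $f_\ell$ is the unique continuous function $f_\ell:\mathbb{Z}_{11}\to\mathbb{Z}_{11}$ with $f_\ell(m)=T_{\ell+110m}$ for all $m\in\mathbb{Z}$; explicitly $f_\ell(z)=\sum_{\lambda}c_\lambda\lambda^\ell\exp(z\log\lambda^{110})$, where $\lambda$ runs over the three roots of $P(X)=X^3-X^2-X-1$ in $\mathbb{Q}_{11}[\sqrt{22}]$ and $c_\lambda=(\lambda P'(\lambda))^{-1}\lambda^{2}=\lambda/P'(\lambda)$. The set of rational zeros of the Tribonacci sequence is $\{-17,-4,-5/3,-1,0,1/3\}$ (here $1/3$ and $-5/3$ are zeros in the sense that the Binet formula $\sum_\lambda c_\lambda\lambda^{n}$ vanishes there for suitable choices of the cube roots of the $\lambda$'s); modulo $110$ (coprime to $3$) these are congruent to $93,106,35,109,0,37$ respectively.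
   Formalization: The printed formula ν_11(T_n)=ν_11(n+c)+1 is false (n=35, c=5/3: T_35=615693474 has valuation 1, while ν_11(110/3)+1=2); the formal theorem proves ν_11(T_n)=ν_11(n+c) for all n in the six classes. *)

(* Defs.v *)
From HB Require Import structures.
From mathcomp Require Import all_boot all_order all_algebra.
From mathcomp Require Import all_classical all_reals all_analysis.

Set Implicit Arguments.
Unset Strict Implicit.
Unset Printing Implicit Defensive.

Import Order.TTheory GRing.Theory Num.Theory.

Local Open Scope classical_set_scope.
Local Open Scope ring_scope.

(** * The ring of p-adic integers *)

(** A p-adic integer is a compatible sequence of residues: [x n] is the
    residue modulo [p ^ n].  The single equation below says both that [x n] is
    the canonical representative in [0, p ^ n) and that [x n.+1] reduces to
    [x n]. *)
Record padic_int (p : nat) (p_pr : prime p) : Type := PadicInt {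
  residue :> nat -> int;
  residueP : forall n, residue n = (residue n.+1 %% p%:Z ^+ n)%Z }.

Section PadicRing.
Variables (p : nat) (p_pr : prime p).
Local Notation Zp := (padic_int p_pr).
Implicit Types x y z : Zp.

Lemma padic_ext x y : (forall n, x n = y n) -> x = y.
Proof.
case: x y => [x xP] [y yP] /= /funext exy; rewrite {}exy in xP *.
by congr PadicInt; apply: Prop_irrelevance.
Qed.

Lemma residue_mod x n : (x n %% p%:Z ^+ n)%Z = x n.
Proof. by rewrite residueP modz_mod. Qed.

Lemma modz_expS (a : int) n :
  ((a %% p%:Z ^+ n.+1)%Z %% p%:Z ^+ n)%Z = (a %% p%:Z ^+ n)%Z.
Proof. by rewrite [in RHS](divz_eq a (p%:Z ^+ n.+1)) exprS mulrA modzMDl. Qed.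

Fact of_seq_subproof (u : nat -> int) :
    (forall n, (u n = u n.+1 %[mod p%:Z ^+ n])%Z) ->
  forall n, (u n %% p%:Z ^+ n)%Z = ((u n.+1 %% p%:Z ^+ n.+1)%Z %% p%:Z ^+ n)%Z.
Proof. by move=> uP n; rewrite modz_expS. Qed.

Definition padic_of_seq (u : nat -> int)
    (uP : forall n, (u n = u n.+1 %[mod p%:Z ^+ n])%Z) : Zp :=
  PadicInt p_pr (of_seq_subproof uP).

Fact padic_const_subproof (a : int) n : (a = a %[mod p%:Z ^+ n])%Z.
Proof. by []. Qed.

Fact padic_opp_subproof x n : (- x n = - x n.+1 %[mod p%:Z ^+ n])%Z.
Proof. by rewrite (residueP x) modzNm. Qed.

Fact padic_add_subproof x y n :
  (x n + y n = x n.+1 + y n.+1 %[mod p%:Z ^+ n])%Z.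
Proof. by rewrite (residueP x) (residueP y) modzDm. Qed.

Fact padic_mul_subproof x y n :
  (x n * y n = x n.+1 * y n.+1 %[mod p%:Z ^+ n])%Z.
Proof. by rewrite (residueP x) (residueP y) modzMm. Qed.

Definition padic_const a : Zp := padic_of_seq (padic_const_subproof a).
Definition padic_opp x : Zp := padic_of_seq (padic_opp_subproof x).
Definition padic_add x y : Zp := padic_of_seq (padic_add_subproof x y).
Definition padic_mul x y : Zp := padic_of_seq (padic_mul_subproof x y).

HB.instance Definition _ := gen_eqMixin Zp.
HB.instance Definition _ := gen_choiceMixin Zp.

Fact padic_addA : associative padic_add.
Proof. by move=> x y z; apply: padic_ext => n /=; rewrite modzDml modzDmr addrA. Qed.

Fact padic_addC : commutative padic_add.
Proof. by move=> x y; apply: padic_ext => n /=; rewrite addrC. Qed.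

Fact padic_add0 : left_id (padic_const 0) padic_add.
Proof. by move=> x; apply: padic_ext => n /=; rewrite modzDml add0r residue_mod. Qed.

Fact padic_addN : left_inverse (padic_const 0) padic_opp padic_add.
Proof. by move=> x; apply: padic_ext => n /=; rewrite modzDml addNr. Qed.

HB.instance Definition _ :=
  GRing.isZmodule.Build Zp padic_addA padic_addC padic_add0 padic_addN.

Fact padic_mulA : associative padic_mul.
Proof. by move=> x y z; apply: padic_ext => n /=; rewrite modzMml modzMmr mulrA. Qed.

Fact padic_mulC : commutative padic_mul.
Proof. by move=> x y; apply: padic_ext => n /=; rewrite mulrC. Qed.

Fact padic_mul1 : left_id (padic_const 1) padic_mul.
Proof. by move=> x; apply: padic_ext => n /=; rewrite modzMml mul1r residue_mod. Qed.

Fact padic_mulD : left_distributive padic_mul padic_add.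
Proof.
by move=> x y z; apply: padic_ext => n /=; rewrite modzMml modzDml modzDmr mulrDl.
Qed.

Fact padic_1_neq0 : padic_const 1 != 0.
Proof.
apply/eqP => /(congr1 (fun x : Zp => x 1%N)) /=.
by rewrite expr1 mod0z modz_small // ltz_nat prime_gt1.
Qed.

HB.instance Definition _ := GRing.Zmodule_isComNzRing.Build Zp
  padic_mulA padic_mulC padic_mul1 padic_mulD padic_1_neq0.

Definition padic_unit : pred Zp := fun x => `[< exists y : Zp, y * x = 1 >].

Definition padic_inv x : Zp :=
  if pselect (exists y : Zp, y * x = 1) is left ex then projT1 (cid ex) else x.

Fact padic_mulV : {in padic_unit, left_inverse 1 padic_inv *%R}.
Proof.
move=> x /asboolP ux; rewrite /padic_inv.
by case: pselect => // ex; case: cid.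
Qed.

Fact padic_unitPl x y : y * x = 1 -> padic_unit x.
Proof. by move=> yx; apply/asboolP; exists y. Qed.

Fact padic_inv_out : {in [predC padic_unit], padic_inv =1 id}.
Proof.
move=> x; rewrite inE /= => /negP ux; rewrite /padic_inv.
by case: pselect => // ex; case: ux; apply/asboolP.
Qed.

HB.instance Definition _ := GRing.ComNzRing_hasMulInverse.Build Zp
  padic_mulV padic_unitPl padic_inv_out.

(** The p-adic uniformity: a basis of entourages is given by the relations
    of congruence modulo [p ^ n], i.e. of being at p-adic distance at most
    [p ^ - n]. *)
Definition padic_ent : set_system (Zp * Zp) :=
  [set E | exists n, forall x y : Zp, x n = y n -> E (x, y)].

Lemma residue_le x y m n : (m <= n)%N -> x n = y n -> x m = y m.
Proof.
move=> /subnK <-; elim: (n - m)%N => [|k IH] // e; apply: IH.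
by rewrite (residueP x) (residueP y) -addSn e.
Qed.

Fact padic_ent_filter : Filter padic_ent.
Proof.
split; first by exists 0%N.
- move=> A B [m Am] [n Bn]; exists (maxn m n) => x y e; split.
  + by apply: Am; apply: residue_le e; apply: leq_maxl.
  + by apply: Bn; apply: residue_le e; apply: leq_maxr.
- by move=> A B AB [n An]; exists n => x y e; apply/AB/An.
Qed.

Local Open Scope relation_scope.

Fact padic_ent_diag E : padic_ent E -> diagonal `<=` E.
Proof. by case=> n nE [x y] xy; apply: nE; congr (residue _ n). Qed.

Fact padic_ent_inv E : padic_ent E -> padic_ent E^-1.
Proof. by case=> n nE; exists n => x y e; apply: nE. Qed.

Fact padic_ent_split E : padic_ent E -> exists2 B, padic_ent B & B \; B `<=` E.
Proof.
case=> n nE; exists [set xy : Zp * Zp | xy.1 n = xy.2 n]; first by exists n.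
by case=> x y /= [z /= xz zy]; apply: nE; rewrite xz.
Qed.

Local Close Scope relation_scope.

HB.instance Definition _ := isUniform.Build Zp
  padic_ent_filter padic_ent_diag padic_ent_inv padic_ent_split.

Lemma padic_continuousP (f : Zp -> Zp) : continuous f <->
  forall (x : Zp) (n : nat), exists k : nat,
    forall y : Zp, x k = y k -> f x n = f y n.
Proof.
split=> [fc x n|H x].
- have /fc /nbhsP [E [k kE] EA] : nbhs (f x) [set y : Zp | f x n = y n].
    apply/nbhsP; exists [set xy : Zp * Zp | xy.1 n = xy.2 n]; first by exists n.
    by move=> y /xsectionP.
  by exists k => y xy; apply: EA; apply/xsectionP; apply: kE.
- move=> A /nbhsP [E [n nE] EA]; have [k Hk] := H x n.
  apply/nbhsP; exists [set xy : Zp * Zp | xy.1 k = xy.2 k]; first by exists k.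
  by move=> y /xsectionP /= xy; apply: EA; apply/xsectionP/nE/Hk.
Qed.

Lemma intr_residue (a : int) n : (a%:~R : Zp) n = (a %% p%:Z ^+ n)%Z.
Proof.
suff -> : a%:~R = padic_const a by [].
have natE k : (k%:R : Zp) = padic_const k%:Z.
  elim: k => [|k IH] //; rewrite -natr1 IH; apply: padic_ext => i /=.
  by rewrite modzDm -addn1 PoszD.
case: a => k; first exact: natE.
rewrite NegzE mulrNz [_%:~R]natE; apply: padic_ext => i /=.
by rewrite modzNm.
Qed.

End PadicRing.

Notation Z_11 := (@padic_int 11 isT).

(** The p-adic valuation of a rational number, with value [+oo] at 0. *)
Definition padic_val (p : nat) (q : rat) : \bar int :=
  if q == 0 then +oo%E
  else ((logn p `|numq q|)%:Z - (logn p `|denq q|)%:Z)%:E.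

(** * The Tribonacci sequence *)

(** [trib] is the first component of the state (T_n, T_(n+1), T_(n+2)),
    which starts at (0, 1, 1) and is moved forwards or backwards. *)
Definition trib_next (s : int * int * int) : int * int * int :=
  let: (a, b, c) := s in (b, c, c + b + a).
Definition trib_prev (s : int * int * int) : int * int * int :=
  let: (a, b, c) := s in (c - b - a, a, b).

Definition trib_state (n : int) : int * int * int :=
  match n with
  | Posz k => iter k trib_next (0, 1, 1)
  | Negz k => iter k.+1 trib_prev (0, 1, 1)
  end.

Definition trib (n : int) : int := (trib_state n).1.1.

Lemma trib_prevK : cancel trib_prev trib_next.
Proof. by case=> [[a b] c] /=; rewrite -[c - b - a]addrA -opprD [b + a + _]addrC subrK. Qed.

Lemma trib_state_next n : trib_state (n + 1) = trib_next (trib_state n).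
Proof.
case: n => k; first by rewrite -PoszD addn1.
rewrite [trib_state (Negz k)]/= trib_prevK.
by case: k => [|k] //; rewrite !NegzE -addn1 PoszD opprD addrNK -NegzE.
Qed.

Lemma trib0 : trib 0 = 0. Proof. by []. Qed.
Lemma trib1 : trib 1 = 1. Proof. by []. Qed.
Lemma trib2 : trib 2 = 1. Proof. by []. Qed.

Lemma trib_rec n : trib (n + 3) = trib (n + 2) + trib (n + 1) + trib n.
Proof.
rewrite (_ : n + 3 = n + 1 + 1 + 1); last by rewrite -!addrA.
rewrite (_ : n + 2 = n + 1 + 1); last by rewrite -!addrA.
by rewrite /trib !trib_state_next; case: (trib_state n) => [[a b] c].
Qed.

(** [f] is the 11-adic interpolation of the subsequence of index [l]
    modulo 110. *)
Definition is_interpolation (l : nat) (f : Z_11 -> Z_11) : Prop :=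
  continuous f /\ forall m : int, f m%:~R = (trib (l%:Z + 110 * m))%:~R.

(** The pairs (l, zeta) where zeta is a rational zero of the Tribonacci
    sequence and l is the residue of zeta modulo 110. *)
Definition rational_zeros : seq (nat * rat) :=
  [:: (0%N, 0); (109%N, - 1); (106%N, - 4%:R); (93%N, - 17%:R);
      (37%N, 1 / 3%:R); (35%N, - (5%:R / 3%:R))].

(* Main.v *)
Require Import Defs.
From mathcomp Require Import all_boot all_order all_algebra.
From mathcomp Require Import all_classical all_reals all_analysis.
From mathcomp Require Import ring zify.

Import Order.TTheory GRing.Theory Num.Theory.

Local Open Scope classical_set_scope.
Local Open Scope ring_scope.

(** Let [x] be a root of [X^3 - X^2 - X - 1].  Since [x ^+ 110 = 1 + 11 * b]
    ([exp110]), the binomial formula shows that [m |-> trib (n + 110 * m)] is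
    affine up to a higher order term: if [11 ^+ j] divides [a - b], then
    [trib (n + 110 * a) - trib (n + 110 * b)] is [(a - b) * (trib (n + 110) - trib n)]
    modulo [11 ^+ j.+2] ([dvd_trib_diff]).  The slope is a multiple of 11, so the
    values at the residues of an 11-adic integer [z] converge; their limit is the
    interpolation, and density of the integers makes it the only one.

    A table modulo 121 shows that [trib] vanishes modulo 11 on exactly ten classes
    modulo 110, and that on these the slope is not divisible by 121
    ([trib_regular]).  The interpolation of such a class therefore divides
    distances by exactly 11 ([trib_expansive]); it has at most one zero, and
    Newton iteration with constant slope produces one ([interp_zero_unique]).  On the
    other classes there is no zero and [trib] is prime to 11.

    A rational number [p / q] is treated as a limit of integer indices along which
    [trib] tends to 0 ([adherent_zero]).  By expansiveness [trib n] and [q * n - p]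
    are then divisible by the same powers of 11 for all [n] of the class
    ([dvd_trib_adherent]), which gives at once the valuations and the place of the
    zero of the interpolation.  For the integers 0, -1, -4, -17 the limit is
    attained.  For 1/3 and -5/3, let [y = x ^+ 2 - x].  Then [y ^+ 3 = 2 * x]
    ([tribP_cube]) and [y ^+ 110] is 1 modulo 11 ([exp110_cube_root]).  If [3 * k] tends
    to 1 while staying 1 modulo 110, then [2 ^+ k * x ^+ k = y ^+ (3 * k)] tends to
    [y], hence [2 ^+ k * trib (n + k)] is close to [trib (n + 2) - trib (n + 1)]
    ([dvd_trib_third]), which is 0 for [n = 0] and for [n = - 2].

    The zeros of the classes 8, 14, 42, 61 are not rational zeros because an equality
    [l + 110 * z = p / q] determines [l] modulo 11, and these four classes differ
    modulo 11 from the six classes of the rational zeros. *)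

(** * Powers of one plus a multiple of eleven *)

Lemma ltn_logn11 i : (1 < i -> logn 11 i + 2 <= i)%N.
Proof.
move=> i_gt1; have i_gt0 : (0 < i)%N by exact: ltnW.
have le_i : (11 ^ logn 11 i <= i)%N by apply: dvdn_leq => //; apply: pfactor_dvdnn.
case: (logn 11 i) le_i => [|a]; first by rewrite add0n.
have : (10 * a.+1 < 11 ^ a.+1)%N.
  by elim: a => // a IH; rewrite expnS; move: IH; lia.
by move=> lt_a; lia.
Qed.

(** From [i * 'C(k, i) = k * 'C(k.-1, i.-1)] the binomial coefficient loses at
    most [logn 11 i] of the factors 11 of [k], and [11 ^ i] pays for that loss
    with two factors to spare as soon as [1 < i]. *)
Lemma dvdn_bin11 j k i : (11 ^ j %| k -> 1 < i -> 11 ^ j.+2 %| 11 ^ i * 'C(k, i))%N.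
Proof.
move=> jk i_gt1.
have [->|C_gt0] := posnP 'C(k, i); first by rewrite muln0.
have k_gt0 : (0 < k)%N by case: k C_gt0 {jk} => //; case: i i_gt1.
have lt1 := ltn_logn11 i i_gt1.
rewrite pfactor_dvdn // ?muln_gt0 ?expn_gt0 //.
have : (11 ^ j %| i * 'C(k, i))%N.
  by case: i i_gt1 {lt1 C_gt0} => // i _; rewrite -mul_bin_diag dvdn_mulr.
rewrite pfactor_dvdn ?muln_gt0 ?(ltnW i_gt1) // !lognM ?expn_gt0 //; last exact: ltnW.
by rewrite pfactorK //; lia.
Qed.

(** The gain of two factors in the error term, against one in the linear term,
    is what makes the interpolations locally linear. *)
Lemma expr_1D11 (R : comNzRingType) (b : R) j k : (11 ^ j %| k)%N ->
  exists c, (1 + 11%:R * b) ^+ k = 1 + 11%:R * k%:R * b + 11%:R ^+ j.+2 * c.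
Proof.
move=> jk.
have term i : (1 < i)%N ->
    exists c, (11%:R * b) ^+ i *+ 'C(k, i) = 11%:R ^+ j.+2 * c.
  move=> /(dvdn_bin11 j k i jk) /dvdnP [q qE]; exists (q%:R * b ^+ i).
  move: (congr1 (fun m => m%:R : R) qE); rewrite natrM [in RHS]natrM !natrX => {}qE.
  by rewrite -[LHS]mulr_natr exprMn mulrAC qE; ring.
rewrite addrC exprD1n.
case: k jk term => [|k] jk term.
  by exists 0; rewrite big_ord_recl big_ord0 bin0 !(mulr0, mul0r) !addr0.
rewrite 2!big_ord_recl bin0 bin1 !mulr1n expr0 expr1 /=.
suff [c ->] : exists c, \sum_(i < k) (11%:R * b) ^+ bump 0 (bump 0 i)
    *+ 'C(k.+1, bump 0 (bump 0 i)) = 11%:R ^+ j.+2 * c.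
  by exists c; rewrite -[_ *+ k.+1]mulr_natr; ring.
apply: (big_ind (fun s => exists c, s = 11%:R ^+ j.+2 * c)).
- by exists 0; rewrite mulr0.
- by move=> _ _ [c ->] [d ->]; exists (c + d); rewrite mulrDr.
- by move=> i _; apply: term.
Qed.

(** * The action of polynomials on the Tribonacci sequence *)

(** Congruences in [Z[X] / (X^3 - X^2 - X - 1)] are written as equalities in a
    commutative ring up to a multiple [tribP x * q]. *)
Definition tribP (R : comNzRingType) (x : R) : R := x ^+ 3 - x ^+ 2 - x - 1.

Definition trib_mx : 'M[int]_3 :=
  \matrix_(i < 3, j < 3) (if i == 2 :> nat then 1 else (j == i.+1 :> nat)%:R).
Definition trib_col n : 'cV[int]_3 := \col_i trib (n + i%:Z).

(** The linear functional that sends ['X^k] to [trib (n + k)]; it kills the ideal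
    generated by [tribP 'X], so congruences between polynomials become
    congruences between Tribonacci numbers. *)
Definition trib_act n (p : {poly int}) : int :=
  (horner_mx trib_mx p *m trib_col n) 0 0.

Lemma trib_mx_col n : trib_mx *m trib_col n = trib_col (n + 1).
Proof.
apply/matrixP => i j; rewrite !mxE !big_ord_recl big_ord0 !mxE /=.
case: i => [[|[|[|//]]] ?] /=; rewrite !(mul0r, mul1r, add0r, addr0).
- by [].
- by rewrite -addrA.
- rewrite -[n + 1 + 2]addrA trib_rec; ring.
Qed.

Lemma trib_mx_expr n k : trib_mx ^+ k *m trib_col n = trib_col (n + k%:Z).
Proof.
elim: k => [|k IH]; first by rewrite expr0 mul1mx addr0.
by rewrite exprS -mulmxA IH trib_mx_col -addrA -PoszD addn1.
Qed.

Lemma horner_mx_Xn k : horner_mx trib_mx 'X^k = trib_mx ^+ k.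
Proof. by rewrite rmorphXn /= horner_mx_X. Qed.

Lemma trib_act_tribP n : horner_mx trib_mx (tribP _ 'X) *m trib_col n = 0.
Proof.
rewrite /tribP !rmorphB /= rmorph1 !horner_mx_Xn horner_mx_X.
rewrite !mulmxBl !trib_mx_expr trib_mx_col mul1mx.
apply/matrixP => i j; rewrite !mxE.
rewrite (_ : n + 3 + i = n + i + 3); last by ring.
rewrite (_ : n + 2 + i = n + i + 2); last by ring.
rewrite (_ : n + 1 + i = n + i + 1); last by ring.
by rewrite trib_rec; ring.
Qed.

Lemma trib_actD n p q : trib_act n (p + q) = trib_act n p + trib_act n q.
Proof. by rewrite /trib_act rmorphD mulmxDl mxE. Qed.

Lemma trib_actN n p : trib_act n (- p) = - trib_act n p.
Proof. by rewrite /trib_act rmorphN mulNmx mxE. Qed.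

Lemma trib_actZ n a p : trib_act n (a%:~R * p) = a * trib_act n p.
Proof.
by rewrite /trib_act mulrzl rmorphMz /= -scaler_int -scalemxAl mxE intz.
Qed.

Lemma trib_actX n k : trib_act n 'X^k = trib (n + k%:Z).
Proof. by rewrite /trib_act horner_mx_Xn trib_mx_expr mxE addr0. Qed.

Lemma trib_actP n q : trib_act n (tribP _ 'X * q) = 0.
Proof. by rewrite mulrC /trib_act rmorphM -mulmxA trib_act_tribP mulmx0 mxE. Qed.

(** * Powers of a root of the characteristic polynomial *)

Lemma trib_nat_rec (k : nat) : trib k.+3 = trib k.+2 + trib k.+1 + trib k.
Proof. by rewrite /trib /=; case: (iter k _ _) => [[a b] c]. Qed.

Lemma exp_trib (R : comNzRingType) (x : R) k : exists q,
  x ^+ (k + 3) = (trib k.+2)%:~R * x ^+ 2 + (trib k.+1 + trib k)%:~R * x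
               + (trib k.+1)%:~R + tribP R x * q.
Proof.
elim: k => [|k [q qE]].
  exists 1; rewrite trib0 trib1 trib2 addr0 add0n /tribP; ring.
exists (x * q + (trib k.+2)%:~R).
rewrite trib_nat_rec addSn exprS qE /tribP.
move: (trib k) (trib k.+1) (trib k.+2) => a b c.
ring.
Qed.

(** * Tribonacci numbers modulo 121 *)

Definition trib_step121 (s : nat * nat * nat) : nat * nat * nat :=
  let: (a, b, c) := s in (b, c, (c + b + a) %% 121)%N.

Lemma trib_mod121 (k : nat) :
  (trib k == (iter k trib_step121 (0, 1, 1)%N).1.1 %[mod 121])%Z.
Proof.
suff : let: (a, b, c) := iter k trib_step121 (0, 1, 1)%N in
    [&& trib k == a %[mod 121], trib k.+1 == b %[mod 121]
      & trib k.+2 == c %[mod 121]]%Z.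
  by case: (iter _ _ _) => [[a b] c] /and3P[].
elim: k => // k; rewrite iterS; case: (iter _ _ _) => [[a b] c] /and3P[ka kb kc].
rewrite /= kb kc trib_nat_rec -modz_nat modz_mod !PoszD.
rewrite eqz_mod_dvd /=; move: ka kb kc; rewrite !eqz_mod_dvd => ka kb kc.
rewrite (_ : _ - _ = (trib k.+2 - c%:Z) + (trib k.+1 - b%:Z) + (trib k - a%:Z)); last by ring.
by rewrite rpredD ?ka 1?rpredD ?kb ?kc.
Qed.

Definition trib_table := [seq s.1.1 | s <- traject trib_step121 (0, 1, 1)%N 220].

Lemma trib_tableE (k : nat) : (k < 220)%N -> (trib k == nth 0%N trib_table k %[mod 121])%Z.
Proof.
rewrite /trib_table; move: 220%N => n k_lt.
by rewrite (nth_map (0, 1, 1)%N) ?size_traject // nth_traject // trib_mod121.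
Qed.

Lemma dvd_trib_table (d k : nat) : (d %| 121)%N -> (k < 220)%N ->
  (d %| trib k)%Z = (d %| nth 0%N trib_table k)%N.
Proof.
move=> d121 /trib_tableE; rewrite eqz_mod_dvd => tE.
have {}tE : (d %| trib k - (nth 0%N trib_table k)%:Z)%Z by apply: dvdz_trans tE; exact: d121.
by rewrite -[trib k](subrK (nth 0%N trib_table k)%:Z) rpredDl.
Qed.

(** The classes modulo 110 on which the sequence vanishes modulo 11. *)
Definition zero_classes : seq nat := [:: 0; 8; 14; 35; 37; 42; 61; 93; 106; 109]%N.

Lemma dvd11_trib (l : nat) : (l < 110)%N -> (11 %| trib l)%Z = (l \in zero_classes).
Proof.
move=> l_lt; rewrite dvd_trib_table //; last exact: ltn_trans l_lt _.
have : all (fun l => (11 %| nth 0%N trib_table l)%N == (l \in zero_classes))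
  (iota 0 110) by vm_compute.
by move/allP/(_ l); rewrite mem_iota => /(_ l_lt)/eqP.
Qed.

Lemma trib_regular (l : nat) : l \in zero_classes -> ~~ (121 %| trib (l%:Z + 110) - trib l)%Z.
Proof.
move=> lz; have l_lt : (l < 110)%N by move: l lz; apply/allP.
have /trib_tableE tl : (l < 220)%N by exact: ltn_trans l_lt _.
have /trib_tableE tl' : (l + 110 < 220)%N by rewrite (ltn_add2r 110 l 110).
rewrite -eqz_mod_dvd (eqP tl) -PoszD (eqP tl') !modz_nat eqz_nat.
have : all (fun l => nth 0 trib_table (l + 110) %% 121 !=
  nth 0 trib_table l %% 121)%N zero_classes by vm_compute.
by move/allP/(_ l lz).
Qed.

Lemma trib_mod11 (k r : nat) : (k < 220)%N -> (nth 0%N trib_table k %% 11)%N = r ->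
  exists q, trib k = r%:Z + 11 * q.
Proof.
move=> /trib_tableE; rewrite eqz_mod_dvd => /dvdzP[q tE] <-.
exists (11 * q + (nth 0%N trib_table k %/ 11)%:Z).
rewrite -[trib k](subrK (nth 0%N trib_table k)%:Z) tE.
rewrite {1}(divn_eq (nth 0%N trib_table k) 11) PoszD PoszM; ring.
Qed.

(** * The order of the roots modulo 11 *)

Lemma exp_congr (R : comNzRingType) (y z p q : R) k : y = z + p * q ->
  exists d, y ^+ k = z ^+ k + p * d.
Proof.
move=> yE; exists (q * \sum_(i < k) y ^+ (k.-1 - i) * z ^+ i).
have yz : y - z = p * q by rewrite yE addrC addKr.
by rewrite -[y ^+ k](subrK (z ^+ k)) subrXX yz addrC -mulrA.
Qed.

Lemma exp_congr_1D11 (R : comNzRingType) (y p b q : R) j k : (11 ^ j %| k)%N ->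
  y = 1 + 11%:R * b + p * q -> exists c d,
  y ^+ k = 1 + 11%:R * k%:R * b + 11%:R ^+ j.+2 * c + p * d.
Proof.
move=> jk yE; have [c cE] := expr_1D11 R b j k jk.
have [d dE] := exp_congr _ _ _ _ _ k yE.
by exists c, d; rewrite dE cE.
Qed.

(** The expansion of [x ^+ 110] has the coefficients [trib 109], [trib 108 + trib 107]
    and [trib 108], which are 0, 0 and 1 modulo 11. *)
Lemma exp110 (R : comNzRingType) (x : R) : exists b q,
  x ^+ 110 = 1 + 11%:R * b + tribP R x * q.
Proof.
have [q qE] := exp_trib R x 107.
have [u uE] := trib_mod11 109 0 isT (erefl _).
have [v vE] := trib_mod11 108 1 isT (erefl _).
have [w wE] := trib_mod11 107 10 isT (erefl _).
rewrite uE vE wE in qE.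
exists (u%:~R * x ^+ 2 + (v + w + 1)%:~R * x + v%:~R), q.
rewrite -[110%N]/(107 + 3)%N qE; ring.
Qed.

(** This identity explains the zeros 1/3 and -5/3: up to the constant 2, the
    element [x ^+ 2 - x] is a cube root of the root [x], and in the basis
    [1, x, x ^+ 2] its constant coefficient and the sum of its other two vanish. *)
Lemma tribP_cube (R : comNzRingType) (x : R) : (x ^+ 2 - x) ^+ 3 =
  2%:R * x + tribP R x * (x ^+ 3 - 2%:R * x ^+ 2 + 2%:R * x).
Proof. rewrite /tribP; ring. Qed.

(** With [y = x ^+ 2 - x], the cubes give [y ^+ 111 = (2 * x) ^+ 37], which is
    congruent to [y] modulo 11, and [y] is invertible modulo 11 because
    [y ^+ 3 = 2 * x]. *)
Lemma exp110_cube_root (R : comNzRingType) (x : R) : exists b q,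
  (x ^+ 2 - x) ^+ 110 = 1 + 11%:R * b + tribP R x * q.
Proof.
set y := x ^+ 2 - x.
have y3 := tribP_cube R x; rewrite -/y in y3.
have [q qE] := exp_trib R x 34.
have [u uE] := trib_mod11 36 8 isT (erefl _).
have [v vE] := trib_mod11 35 0 isT (erefl _).
have [w wE] := trib_mod11 34 3 isT (erefl _).
rewrite uE vE wE -[(34 + 3)%N]/37%N in qE.
set P := tribP R x in qE y3 *.
have [d] := exp_congr _ _ _ _ _ 37 y3; rewrite -exprM -[(3 * 37)%N]/111%N => dE.
(* 2 ^ 35 = (33 - 1) ^ 7, expanded so that no large numeral appears. *)
have two37 : 2%:R ^+ 37 = 7%:R + 11%:R *
    (12%:R * (33%:R ^+ 6 - 7%:R * 33%:R ^+ 5 + 21%:R * 33%:R ^+ 4 - 35%:R * 33%:R ^+ 3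
     + 35%:R * 33%:R ^+ 2 - 21%:R * 33%:R + 7%:R) - 1) :> R by ring.
move: two37; set t := (t in 11%:R * t) => two37.
rewrite exprMn two37 qE in dE.
(* e and c witness y ^+ 111 = y modulo 11 and tribP x; the coefficients of
   7 * x ^+ 37 are 56 = 1 + 55, 21 = - 1 + 22 and 0. *)
pose e := 5%:R * x ^+ 2 + 2%:R * x
  + 7%:R * (u%:~R * x ^+ 2 + (v + w)%:~R * x + v%:~R)
  + t * ((8 + 11 * u)%:~R * x ^+ 2 + (3 + 11 * (v + w))%:~R * x + (11 * v)%:~R).
pose c := (7%:R + 11%:R * t) * q + d.
have {}dE : y ^+ 110 * y = y + 11%:R * e + P * c.
  rewrite -exprSr dE /e /c /y; ring.
(* y * z = 6 * y ^+ 3 * (x ^+ 2 - x - 1) = 12 * x * x^-1, so z inverts y. *)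
pose z := 6%:R * y ^+ 2 * (x ^+ 2 - x - 1).
pose g := (x ^+ 3 - 2%:R * x ^+ 2 + 2%:R * x) * 6%:R * (x ^+ 2 - x - 1) + 12%:R.
have yz : y * z = 1 + 11%:R + P * g.
  have -> : y * z = 6%:R * y ^+ 3 * (x ^+ 2 - x - 1) by rewrite /z; ring.
  rewrite y3 /P /g /tribP; ring.
exists (1 + e * z - y ^+ 110), (g + c * z - g * y ^+ 110).
have : y ^+ 110 * (y * z) = (y + 11%:R * e + P * c) * z by rewrite mulrA dE.
rewrite [RHS]mulrDl [(y + _) * z]mulrDl yz.
move: (y ^+ 110) => Y eY.
apply/eqP; rewrite -subr_eq0; apply/eqP.
rewrite (_ : _ - _ = Y * (1 + 11%:R + P * g)
  - (1 + 11%:R + P * g + 11%:R * e * z + P * c * z)); last by ring.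
by rewrite eY subrr.
Qed.

(** * Congruences for the Tribonacci sequence along multiples of 110 *)

(** The expansion of ['X^110 ^+ k] read through [trib_act n]: the linear term is
    [k] times the action of ['X^110 - 1]. *)
Lemma dvd_trib_shift (n : int) j k : (11 ^ j %| k)%N ->
  (11 ^+ j.+2 %| trib (n + (110 * k)%N%:Z) - trib n - k%:Z * (trib (n + 110) - trib n))%Z.
Proof.
move=> jk; have [b [q XE]] := exp110 {poly int} 'X.
have [c [d XkE]] := exp_congr_1D11 _ _ _ _ _ _ _ jk XE.
have := congr1 (trib_act n) XE; rewrite !trib_actD trib_actP addr0 trib_actX.
have := congr1 (trib_act n) XkE; rewrite -exprM !trib_actD trib_actP addr0 trib_actX.
have -> : trib_act n 1 = trib n by rewrite -[1 in LHS](expr0 'X) trib_actX addr0.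
rewrite -[11%:R * k%:R * b]mulrA -natrX !pmulrn !trib_actZ => -> ->.
set t := trib_act n c.
rewrite (_ : _ - _ = (11 ^ j.+2)%N%:Z * t); last by ring.
by rewrite dvdzE abszM abszX dvdn_mulr.
Qed.

(** When [k] is 11-adically close to 1/3, [y ^+ (3 * k)] is close to [y]; it is
    also [(2 * x) ^+ k], so [2 ^+ k * x ^+ k] acts as [x ^+ 2 - x]. *)
Lemma dvd_trib_third n j k K : (11 ^ j %| K)%N -> (3 * k = 110 * K + 1)%N ->
  (11 ^+ j.+1 %| 2 ^+ k * trib (n + k%:Z) - (trib (n + 2) - trib (n + 1)))%Z.
Proof.
move=> /[dup] jK /dvdnP[K' KE] kK.
have [b [q yE]] := exp110_cube_root {poly int} 'X.
have [c [d yKE]] := exp_congr_1D11 _ _ _ _ _ _ _ jK yE.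
have [e eE] := exp_congr _ _ _ _ _ k (tribP_cube {poly int} 'X).
set y := 'X^2 - 'X in yKE eE.
have : 2%:R ^+ k * 'X^k = y
    + 11%:R ^+ j.+1 * (K'%:R * b * y + 11%:R * c * y) + tribP _ 'X * (d * y - e).
  rewrite -exprMn; apply: (addIr (tribP _ 'X * e)); rewrite -eE.
  rewrite -exprM kK addn1 exprSr exprM yKE KE natrM natrX.
  move: (tribP _ _) => P; rewrite !exprS; ring.
move=> /(congr1 (trib_act n)) E.
rewrite !trib_actD trib_actP addr0 trib_actN -!natrX !pmulrn !trib_actZ !trib_actX in E.
rewrite -['X]expr1 trib_actX in E.
have -> : 2 ^+ k = (2 ^ k)%N :> int by rewrite -natz natrX.
by rewrite E addrAC subrr add0r dvdzE abszM abszX dvdn_mulr.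
Qed.

Lemma dvd11_trib_period n : (11 %| trib (n + 110) - trib n)%Z.
Proof.
have [b [q /(congr1 (trib_act n))]] := exp110 {poly int} 'X.
rewrite !trib_actD trib_actP addr0 trib_actX -[X in trib_act n X + _](expr0 'X).
by rewrite trib_actX addr0 pmulrn trib_actZ => ->; rewrite addrAC subrr add0r dvdz_mulr.
Qed.

(** The affine approximations given by [dvd_trib_shift] at [k + 1] and at [k] differ
    by exactly one slope. *)
Lemma dvd121_trib_diff n (k : int) : (121 %| (trib (n + 110 * k + 110)
  - trib (n + 110 * k)) - (trib (n + 110) - trib n))%Z.
Proof.
have nat_case m (i : nat) : (121 %| (trib (m + 110 * i%:Z + 110)
    - trib (m + 110 * i%:Z)) - (trib (m + 110) - trib m))%Z.
  have h := rpredB (dvd_trib_shift m 0 i.+1 (dvd1n _)) (dvd_trib_shift m 0 i (dvd1n _)).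
  rewrite (_ : m + (110 * i.+1)%N%:Z = m + 110 * i%:Z + 110) in h; last by lia.
  by move: h; rewrite PoszM -addn1 PoszD; congr (_ %| _)%Z; ring.
case: (intP k) => [|i|i]; [exact: (nat_case n 0%N)|exact: nat_case|].
have := nat_case (n - 110 * i.+1%:Z) i.+1.
by rewrite addrNK mulrN -rpredN opprB.
Qed.

(** Negative shifts are covered because the slope is the same modulo 121 at every
    point of the class of [n]. *)
Lemma dvd_trib_diff n (a b : int) j : (11 ^+ j %| a - b)%Z ->
  (11 ^+ j.+2 %| trib (n + 110 * a) - trib (n + 110 * b)
                 - (a - b) * (trib (n + 110) - trib n))%Z.
Proof.
wlog le_ba : a b / b <= a => [IH|] ab.
  have [/IH->//|/ltW /IH] := leP b a.
  rewrite -opprB rpredN ab -rpredN => /(_ isT); congr (_ %| _)%Z; ring.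
have [k kE] : exists k : nat, a = b + k%:Z.
  by exists `|a - b|%N; lia.
have jk : (11 ^ j %| k)%N by move: ab; rewrite kE addrC addKr dvdzE abszX.
have h := dvd_trib_shift (n + 110 * b) j k jk.
have /dvdzP[c cE] := dvd121_trib_diff n b.
have /dvdzP[d dE] := ab.
rewrite kE (_ : n + 110 * (b + k%:Z) = n + 110 * b + (110 * k)%N%:Z); last first.
  by rewrite PoszM; ring.
rewrite -[X in (_ %| X)%Z](subrK (k%:Z * ((trib (n + 110 * b + 110)
  - trib (n + 110 * b)) - (trib (n + 110) - trib n)))) rpredD //.
  by move: h; congr (_ %| _)%Z; ring.
rewrite cE (_ : k%:Z = d * 11 ^+ j); last by rewrite -dE kE; ring.
apply/dvdzP; exists (c * d); rewrite !exprS; ring.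
Qed.

(** The first difference, always a multiple of 11, is 11 times an 11-adic unit. *)
Definition regular (n : int) := ~~ (121 %| trib (n + 110) - trib n)%Z.

Lemma trib_lipschitz n (a b : int) j : (11 ^+ j %| a - b)%Z ->
  (11 ^+ j.+1 %| trib (n + 110 * a) - trib (n + 110 * b))%Z.
Proof.
move=> ab; have h := dvd_trib_diff n _ _ _ ab.
have {}h : (11 ^+ j.+1 %| trib (n + 110 * a) - trib (n + 110 * b)
    - (a - b) * (trib (n + 110) - trib n))%Z.
  by apply: dvdz_trans h; apply: dvdz_exp2l.
rewrite -[X in (_ %| X)%Z](subrK ((a - b) * (trib (n + 110) - trib n))) rpredD //.
by rewrite exprSr dvdz_mul // dvd11_trib_period.
Qed.

Lemma regularP n : regular n ->
  exists2 d, trib (n + 110) - trib n = 11 * d & coprimez 11 d.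
Proof.
rewrite /regular; have /dvdzP[d ->] := dvd11_trib_period n.
rewrite (@dvdz_mul2r 11 11 d isT : (121 %| d * 11)%Z = (11 %| d)%Z) => nd.
by exists d; rewrite 1?mulrC // coprimezE prime_coprime.
Qed.

(** On a regular class, [m |-> trib (n + 110 * m)] divides 11-adic distances by
    exactly 11: this gives both the uniqueness of zeros and the valuations. *)
Lemma trib_expansive n (a b : int) j : regular n ->
  (11 ^+ j.+1 %| trib (n + 110 * a) - trib (n + 110 * b))%Z = (11 ^+ j %| a - b)%Z.
Proof.
move=> /regularP[d dE cd]; apply/idP/idP; last exact: trib_lipschitz.
elim: j => [|j IH] h; first by rewrite dvd1z.
have {}IH : (11 ^+ j %| a - b)%Z.
  by apply: IH; apply: dvdz_trans h; apply: dvdz_exp2l.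
have := rpredB h (dvd_trib_diff n _ _ _ IH); rewrite opprB addrC subrK dE.
rewrite mulrCA exprS dvdz_mul2l // Gauss_dvdzl //.
by apply: coprimezXl.
Qed.

(** Newton iteration with the constant slope [trib (n + 110) - trib n]. *)
Lemma trib_lift n j : (11 %| trib n)%Z -> regular n ->
  exists a : int, (11 ^+ j.+1 %| trib (n + 110 * a))%Z.
Proof.
move=> n0 /regularP[d dE /coprimezP[[v u] /= uv]].
elim: j => [|j [a /dvdzP[t tE]]]; first by exists 0; rewrite mulr0 addr0.
exists (a - 11 ^+ j * (t * u)).
have aa : (11 ^+ j %| a - 11 ^+ j * (t * u) - a)%Z.
  by rewrite addrAC subrr add0r rpredN dvdz_mulr.
have /dvdzP[c cE] := dvd_trib_diff n _ _ _ aa.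
apply/dvdzP; exists (c + t * v).
rewrite -[LHS](subrK (trib (n + 110 * a))) -[X in X + _ = _](subrK
  ((a - 11 ^+ j * (t * u) - a) * (trib (n + 110) - trib n))) cE tE dE.
rewrite [t * 11 ^+ _](_ : _ = t * (v * 11 + u * d) * 11 ^+ j.+1); last by rewrite uv mulr1.
rewrite !exprS; ring.
Qed.

(** * Valuations and rational zeros *)

Lemma ndvd_exp11_inf (a : int) : (forall j, (11 ^+ j %| a)%Z) -> a = 0.
Proof.
move=> aj; apply/eqP; rewrite -absz_eq0; apply: contraT; rewrite -lt0n => a_gt0.
have := aj (logn 11 `|a|).+1; rewrite dvdzE abszX pfactor_dvdn //.
by rewrite ltnn.
Qed.

Lemma padic_val_int (a : int) :
  padic_val 11 a%:~R = if a == 0 then +oo%E else ((logn 11 `|a|)%:Z)%:E.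
Proof. by rewrite /padic_val intr_eq0 numq_int denq_int /= logn1 subr0. Qed.

Lemma eq_padic_val (a b : int) : (forall j, (11 ^+ j %| a)%Z = (11 ^+ j %| b)%Z) ->
  padic_val 11 a%:~R = padic_val 11 b%:~R.
Proof.
move=> ab; rewrite !padic_val_int.
have ab0 : (a == 0) = (b == 0).
  by apply/eqP/eqP => h; apply: ndvd_exp11_inf => j; rewrite (ab, =^~ ab) h dvdz0.
rewrite -ab0; have [//|a_n0] := eqVneq a 0.
have b_n0 : b != 0 by rewrite -ab0.
have {}ab j : (j <= logn 11 `|a|)%N = (j <= logn 11 `|b|)%N.
  by have := ab j; rewrite !dvdzE abszX !pfactor_dvdn // absz_gt0.
by congr (_%:Z%:E); apply/eqP; rewrite eqn_leq -ab leqnn ab leqnn.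
Qed.

Lemma padic_val_frac (a q : int) : 0 < q -> coprimez a q -> coprimez 11 q ->
  padic_val 11 (a%:~R / q%:~R) = padic_val 11 a%:~R.
Proof.
move=> q_gt0 aq q11; have q_n0 : q != 0 by rewrite gt_eqF.
rewrite padic_val_int /padic_val mulf_eq0 invr_eq0 !intr_eq0 (negPf q_n0) orbF.
rewrite coprimeq_num // coprimeq_den // (negPf q_n0) gtr0_sg // mul1r.
by rewrite absz_id [logn 11 `|q|]logn_coprime ?subr0.
Qed.

(** The 11-adic number [p / q] is a limit of indices of the class of [n] along
    which the sequence tends to 0. *)
Definition adherent_zero (n p q : int) := forall j, exists a,
  (11 ^+ j %| q * (n + 110 * a) - p)%Z /\ (11 ^+ j %| trib (n + 110 * a))%Z.

(** Comparing with an index close to [p / q] by [trib_expansive]; the factor 11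
    gained there is the one of [110 * (a - b)]. *)
Lemma dvd_trib_adherent (n p q a : int) j :
  regular n -> coprimez 11 q -> adherent_zero n p q ->
  (11 ^+ j %| trib (n + 110 * a))%Z = (11 ^+ j %| q * (n + 110 * a) - p)%Z.
Proof.
case: j => [|j] nreg q11 zero; first by rewrite !dvd1z.
have [b [bq bT]] := zero j.+1.
rewrite -[in LHS](subrK (trib (n + 110 * b)) (trib _)) rpredDr // trib_expansive //.
rewrite -[X in _ = (_ %| X)%Z](subrK (q * (n + 110 * b) - p)) [RHS]rpredDr //.
rewrite [X in _ = (_ %| X)%Z](_ : _ = 11 * ((q * 10) * (a - b))); last by ring.
rewrite exprS dvdz_mul2l // Gauss_dvdzr // coprimezMr; apply/andP; split.
  exact: coprimezXl.
exact: coprimezXl.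
Qed.

Lemma adherent_zero_int (n p a : int) : p = n + 110 * a -> trib p = 0 ->
  adherent_zero n p 1.
Proof. by move=> pE p0 j; exists a; rewrite mul1r -pE subrr p0. Qed.

(** The index [37 + 110 * a] tends to 1/3 when [3 * a + 1] tends to 0. *)
Lemma adherent_third j : exists2 a : nat, (11 ^ j %| 3 * a + 1)%N &
  forall n, (11 ^+ j %| 2 ^+ (37 + 110 * a) * trib (n + (37 + 110 * a)%N%:Z)
             - (trib (n + 2) - trib (n + 1)))%Z.
Proof.
(* Even powers of 11 are 1 modulo 3, so that a is an integer. *)
have [a aE] : exists a, (121 ^ j = 3 * a + 1)%N.
  elim: j => [|j [a IH]]; first by exists 0%N.
  by exists (121 * a + 40)%N; rewrite expnS IH; lia.
have ja : (11 ^ j %| 3 * a + 1)%N by rewrite -aE dvdn_exp2r.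
exists a => // n.
have kE : (3 * (37 + 110 * a) = 110 * (3 * a + 1) + 1)%N by lia.
by apply: dvdz_trans (dvd_trib_third n _ _ _ ja kE); apply: dvdz_exp2l.
Qed.

(** Apply [adherent_third] from the origin 0: [trib 2 - trib 1 = 0]. *)
Lemma adherent_zero_1_3 : adherent_zero 37 1 3.
Proof.
move=> j; have [a ja /(_ 0) H] := adherent_third j; exists a%:Z.
split.
  rewrite (_ : _ - 1 = 110 * (3 * a + 1)%N%:Z); last by lia.
  by rewrite dvdz_mull // dvdzE abszX.
move: H; rewrite !add0r trib1 trib2 subrr subr0 Gauss_dvdzr.
  by rewrite PoszD PoszM.
by apply: coprimezXl; apply: coprimezXr.
Qed.

(** Apply [adherent_third] from the origin -2, since -5/3 = 1/3 - 2: now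
    [trib 0 - trib (- 1) = 0]. *)
Lemma adherent_zero_5_3 : adherent_zero 35 (- 5) 3.
Proof.
move=> j; have [a ja /(_ (- 2)) H] := adherent_third j; exists a%:Z.
split.
  rewrite (_ : _ - - 5 = 110 * (3 * a + 1)%N%:Z); last by lia.
  by rewrite dvdz_mull // dvdzE abszX.
move: H; rewrite (_ : - 2 + 2 = 0) // (_ : - 2 + 1 = - 1) // trib0.
rewrite (_ : trib (- 1) = 0) // subrr subr0 Gauss_dvdzr.
  by rewrite PoszD PoszM addrA.
by apply: coprimezXl; apply: coprimezXr.
Qed.

Lemma rational_zeroP (l : nat) zeta : (l, zeta) \in rational_zeros ->
  l \in zero_classes /\ exists p q : int,
  [/\ zeta = p%:~R / q%:~R, 0 < q, coprimez p q, coprimez 11 q & adherent_zero l p q].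
Proof.
rewrite /rational_zeros !inE !xpair_eqE.
case/or4P => [|||/or3P[||]] /andP[/eqP-> /eqP->]; split=> //.
- exists 0, 1; rewrite mulr0z mul0r; split=> //; exact: (adherent_zero_int _ _ 0).
- exists (- 1), 1; rewrite divr1; split=> //; exact: (adherent_zero_int _ _ (- 1)).
- exists (- 4), 1; rewrite divr1; split=> //; exact: (adherent_zero_int _ _ (- 1)).
- exists (- 17), 1; rewrite divr1; split=> //; exact: (adherent_zero_int _ _ (- 1)).
- by exists 1, 3; split=> //; exact: adherent_zero_1_3.
- exists (- 5), 3; split=> //; exact: adherent_zero_5_3.
Qed.

(** * The interpolations *)

Lemma padic_eqP (x y : Z_11) : (forall i, (11 ^+ i %| x i - y i)%Z) -> x = y.
Proof.
move=> xy; apply: padic_ext => i; rewrite -(residue_mod x) -(residue_mod y).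
by apply/eqP; rewrite eqz_mod_dvd.
Qed.

Lemma dvd_residueS (x : Z_11) i : (11 ^+ i %| x i - x i.+1)%Z.
Proof. by rewrite -eqz_mod_dvd [x i]residueP modz_mod. Qed.

Fact interp_subproof (n : int) (z : Z_11) i :
  (trib (n + 110 * z i) = trib (n + 110 * z i.+1) %[mod 11%:Z ^+ i])%Z.
Proof.
apply/eqP; rewrite eqz_mod_dvd; have := trib_lipschitz n _ _ _ (dvd_residueS z i).
by apply: dvdz_trans; apply: dvdz_exp2l.
Qed.

Definition interp (n : int) (z : Z_11) : Z_11 :=
  @padic_of_seq 11 isT _ (interp_subproof n z).

Lemma interp_intr (n m : int) : interp n m%:~R = (trib (n + 110 * m))%:~R.
Proof.
apply: padic_eqP => i; rewrite !intr_residue /= intr_residue -eqz_mod_dvd !modz_mod eqz_mod_dvd.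
have mm : (11 ^+ i %| (m %% 11%:Z ^+ i)%Z - m)%Z by rewrite -eqz_mod_dvd modz_mod.
by have := trib_lipschitz n _ _ _ mm; apply: dvdz_trans; apply: dvdz_exp2l.
Qed.

Lemma interp_is_interpolation (l : nat) : is_interpolation l (interp l).
Proof.
split; last exact: interp_intr.
by apply/padic_continuousP => x i; exists i => y /= ->.
Qed.

(** A continuous function is determined by its values at the integers, which are
    dense: the residues of [z] are integers converging to [z]. *)
Lemma interp_unique (l : nat) g : is_interpolation l g -> g = interp l.
Proof.
move=> [/padic_continuousP gc gm]; apply/funext => z; apply: padic_ext => i.
have [k gk] := gc z i; pose m := z (maxn k i).
have zm j : (j <= maxn k i)%N -> z j = (m%:~R : Z_11) j.
  move=> le_j; apply: (residue_le le_j).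
  by rewrite intr_residue residue_mod.
rewrite (gk m%:~R) ?zm ?leq_maxl // gm -interp_intr /=.
by rewrite -zm ?leq_maxr.
Qed.

(** The exponent [i.+1] is one more than the precision of [z i]: the interpolation
    divides distances by at least 11. *)
Lemma interp_eq0 n z :
  interp n z = 0 <-> forall i, (11 ^+ i.+1 %| trib (n + 110 * z i))%Z.
Proof.
split=> [z0 i|z0]; last first.
  apply: padic_eqP => i; rewrite /= mod0z -eqz_mod_dvd modz_mod eqz_mod_dvd subr0.
  by apply: dvdz_trans (z0 i); apply: dvdz_exp2l.
have /= := congr1 (fun x : Z_11 => x i.+1) z0; rewrite mod0z => /dvdz_mod0P zi.
rewrite -[X in (_ %| X)%Z](subrK (trib (n + 110 * z i.+1))) rpredD //.
exact/trib_lipschitz/dvd_residueS.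
Qed.

(** The approximate zeros given by [trib_lift] are chosen independently of each
    other; [trib_expansive] forces them to be compatible. *)
Lemma interp_zero_unique n : (11 %| trib n)%Z -> regular n ->
  exists! z : Z_11, interp n z = 0.
Proof.
move=> n0 nreg; have [a aP] := choice (fun j => trib_lift n j n0 nreg).
have aS i : (a i = a i.+1 %[mod 11%:Z ^+ i])%Z.
  apply/eqP; rewrite eqz_mod_dvd -(trib_expansive n) // rpredB //.
  by apply: dvdz_trans (aP i.+1); apply: dvdz_exp2l.
exists (@padic_of_seq 11 isT _ aS); split=> [|w /interp_eq0 w0].
  apply/interp_eq0 => i /=.
  rewrite -[X in (_ %| X)%Z](subrK (trib (n + 110 * a i))) rpredD //.
  by apply: trib_lipschitz; rewrite -eqz_mod_dvd modz_mod.
apply: padic_eqP => i /=; rewrite -eqz_mod_dvd modz_mod eqz_mod_dvd.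
by rewrite -(trib_expansive n) // rpredB.
Qed.

Lemma padic_unit_coprime (q : int) : coprimez 11 q -> (q%:~R : Z_11) \is a GRing.unit.
Proof.
move=> q11.
have inv i : exists u : int, (11 ^+ i %| u * q - 1)%Z.
  have /coprimezP[[v u] /= uv] := coprimezXl i q11.
  by exists u; apply/dvdzP; exists (- v); rewrite -[X in _ - X]uv; ring.
have [u uP] := choice inv.
have uS i : (u i = u i.+1 %[mod 11%:Z ^+ i])%Z.
  apply/eqP; rewrite eqz_mod_dvd -(@Gauss_dvdzl _ _ q) ?coprimezXl //.
  rewrite mulrBl -[u i * q](subrK 1) -addrA rpredD // -opprB rpredN.
  by apply: dvdz_trans (uP i.+1); apply: dvdz_exp2l.
apply/asboolP; exists (@padic_of_seq 11 isT _ uS); apply: padic_eqP => i /=.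
rewrite intr_residue -eqz_mod_dvd !modz_mod modzMml modzMmr.
by rewrite eqz_mod_dvd.
Qed.

Lemma residueD (x y : Z_11) i : (x + y) i = ((x i + y i) %% 11%:Z ^+ i)%Z.
Proof. by []. Qed.

Lemma residueM (x y : Z_11) i : (x * y) i = ((x i * y i) %% 11%:Z ^+ i)%Z.
Proof. by []. Qed.

Lemma padic_lin_eqP (p q : int) (l : nat) (z : Z_11) :
  q%:~R * (l%:R + 110%:R * z) = p%:~R <->
  forall i, (11 ^+ i %| q * (l%:Z + 110 * z i) - p)%Z.
Proof.
have res i : (q%:~R * (l%:R + 110%:R * z) : Z_11) i =
    (q * (l%:Z + 110 * z i) %% 11%:Z ^+ i)%Z.
  rewrite !pmulrn residueM residueD residueM !intr_residue modzMml modzMmr.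
  by rewrite -[LHS]modzMmr modzDml modzDmr -[LHS]modzMmr -modzDmr modzMml modzDmr !modzMmr.
split=> [e i|e].
  by rewrite -eqz_mod_dvd -res e intr_residue.
apply: padic_eqP => i; rewrite res intr_residue -eqz_mod_dvd !modz_mod eqz_mod_dvd.
exact: e.
Qed.

Lemma eq_ratrP (p q : int) (l : nat) (z : Z_11) :
  0 < q -> coprimez p q -> coprimez 11 q ->
  (l%:R + 110%:R * z = ratr (p%:~R / q%:~R)) <->
  forall i, (11 ^+ i %| q * (l%:Z + 110 * z i) - p)%Z.
Proof.
move=> q_gt0 pq q11; have uq := padic_unit_coprime q q11.
have -> : ratr (p%:~R / q%:~R) = p%:~R / q%:~R :> Z_11.
  rewrite /ratr coprimeq_num // coprimeq_den // gt_eqF // gtr0_sg // mul1r.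
  by rewrite gtr0_norm.
rewrite -padic_lin_eqP; split=> [->|<-]; first by rewrite mulrC divrK.
by rewrite [RHS]mulrC mulKr.
Qed.

(** * The theorem *)

Theorem mainTheorem3 :
  (forall l : 'I_110, exists! g : Z_11 -> Z_11, is_interpolation l g) /\
  (forall f : 'I_110 -> Z_11 -> Z_11,
  (forall l : 'I_110, is_interpolation l (f l)) ->
  [/\ ([set lz : 'I_110 * Z_11 | f lz.1 lz.2 = 0] #= `I_10)%card,
      forall l : 'I_110,
        val l \in [:: 0; 8; 14; 35; 37; 42; 61; 93; 106; 109]%N ->
        exists! z : Z_11, f l z = 0,
      forall (l : 'I_110) (zeta : rat) (z : Z_11),
        (val l, zeta) \in rational_zeros -> f l z = 0 ->
        (val l)%:R + 110%:R * z = ratr zeta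
    & forall (l : 'I_110) (z : Z_11),
        val l \in [:: 8; 14; 42; 61]%N -> f l z = 0 ->
        forall zeta : rat, zeta \in [seq lzeta.2 | lzeta <- rational_zeros] ->
        (val l)%:R + 110%:R * z <> ratr zeta]) /\
  forall n : int,
    (forall (l : nat) (zeta c : rat),
       (l, zeta) \in rational_zeros -> c = - zeta ->
       (n = l%:Z %[mod 110])%Z ->
       padic_val 11 (trib n)%:~R = padic_val 11 (n%:~R + c)) /\
    ((forall l : nat,
        l \in [:: 0; 8; 14; 35; 37; 42; 61; 93; 106; 109]%N ->
        (n %% 110)%Z <> l%:Z) ->
     padic_val 11 (trib n)%:~R = 0%:E).
Proof.
rewrite -/zero_classes.
have zero_unique (l : nat) : l \in zero_classes -> exists! z, interp l z = 0.
  move=> lz; apply: interp_zero_unique; last exact: trib_regular.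
  by rewrite dvd11_trib //; move: l lz; apply/allP.
have zero_class (l : 'I_110) z : interp l z = 0 -> val l \in zero_classes.
  move=> /interp_eq0/(_ 0%N); rewrite expr1 -(dvd11_trib _ (ltn_ord l)) => l0.
  have := trib_lipschitz l (z 0%N) 0 0 (dvd1z _); rewrite mulr0 addr0 expr1.
  by rewrite rpredBl.
split.
  move=> l; exists (interp l); split; first exact: interp_is_interpolation.
  by move=> g /interp_unique.
split.
  move=> f f_interp.
  have -> : f = (fun l : 'I_110 => interp l) :> ('I_110 -> Z_11 -> Z_11).
    by apply/funext => l; apply: interp_unique.
  split=> [|l|l zeta z|l z l_in _ zeta].
  (* The ten zeros are numbered by the position of their class in the list. *)
  - pose h (lz : 'I_110 * Z_11) := index (val lz.1) zero_classes.
    have <- : h @` [set lz : 'I_110 * Z_11 | interp lz.1 lz.2 = 0] = `I_10.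
      apply/seteqP; split=> [_ [[l z] /= /zero_class lz <-]|i /= i_lt].
        by rewrite /h -[10%N]/(size zero_classes) index_mem.
      have iz : nth 0%N zero_classes i \in zero_classes by apply: mem_nth.
      have i110 : (nth 0%N zero_classes i < 110)%N.
        by move: (nth _ _ _) iz; apply/allP.
      have [z [z0 _]] := zero_unique _ iz.
      exists (Ordinal i110, z); first exact: z0.
      exact: (@index_uniq _ 0%N i zero_classes).
    rewrite card_eq_sym; apply: inj_card_eq => -[l z] [l' z'].
    move=> /set_mem z0 /set_mem z0' ll'.
    have lz : val l \in zero_classes := zero_class _ _ z0.
    have el : l = l'.
      apply: val_inj; rewrite -(nth_index 0%N lz) -[index _ _]/(h (l, z)) ll' nth_index //.
      exact: zero_class z0'.
    rewrite -el in z0' *; congr (_, _).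
    have [w [_ uw]] := zero_unique _ lz.
    exact: etrans (esym (uw z z0)) (uw z' z0').
  - exact: zero_unique.
  - move=> /rational_zeroP[lz [p [q [-> q_gt0 pq q11 adh]]]] /interp_eq0 z0.
    apply/eq_ratrP => // i.
    rewrite -(dvd_trib_adherent _ _ _ _ _ (trib_regular _ lz) q11 adh).
    by apply: dvdz_trans (z0 i); apply: dvdz_exp2l.
  - move=> /mapP[[l' zeta'] in_zeros /= ->].
    have l'_in : l' \in [seq lz.1 | lz <- rational_zeros].
      by apply/mapP; exists (l', zeta').
    have [_ [p [q [-> q_gt0 pq q11 adh]]]] := rational_zeroP _ _ in_zeros.
    move=> /(eq_ratrP _ _ _ _ q_gt0 pq q11)/(_ 1%N).
    (* If l + 110 * z were the rational zero of class l', then l and l' would be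
       equal modulo 11. *)
    have [a [+ _]] := adh 1%N; rewrite !expr1 => al' zl.
    have : (11 %| q * (l%:Z - l'%:Z))%Z.
      rewrite (_ : q * _ = (q * (l%:Z + 110 * z 1%N) - p) - (q * (l'%:Z + 110 * a) - p)
        - 11 * (q * (10 * (z 1%N - a)))); last by ring.
      by rewrite (rpredB (rpredB zl al')) // dvdz_mulr.
    rewrite Gauss_dvdzr // -eqz_mod_dvd !modz_nat eqz_nat.
    have : all (fun i => all (fun j => i %% 11 != j %% 11)%N
      [seq lz.1 | lz <- rational_zeros]) [:: 8; 14; 42; 61]%N by [].
    by move=> /allP/(_ _ l_in)/allP/(_ _ l'_in)/negPf ->.
move=> n; split=> [l zeta c|n_notin].
  move=> /rational_zeroP[lz [p [q [-> q_gt0 pq q11 adh]]]] -> /eqP.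
  rewrite eqz_mod_dvd => /dvdzP[a nE].
  have {}nE : n = l%:Z + 110 * a by rewrite mulrC -nE addrC subrK.
  have -> : n%:~R - p%:~R / q%:~R = (q * n - p)%:~R / q%:~R :> rat.
    by rewrite rmorphB rmorphM /=; field; rewrite intr_eq0 gt_eqF.
  rewrite padic_val_frac //; last first.
    by rewrite coprimez_sym /coprimez mulrC gcdzMDl gcdzN gcdzC.
  apply: eq_padic_val => j; rewrite nE.
  exact: (dvd_trib_adherent _ _ _ _ _ (trib_regular _ lz) q11 adh).
pose l := `|(n %% 110)%Z|%N.
have lE : (n %% 110)%Z = l by rewrite gez0_abs // modz_ge0.
have l_lt : (l < 110)%N by rewrite -ltz_nat -lE ltz_pmod.
have l_notin : l \notin zero_classes by apply/negP => /n_notin; rewrite lE.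
have n0 : ~~ (11 %| trib n)%Z.
  rewrite (divz_eq n 110) lE addrC mulrC.
  have := trib_lipschitz l (n %/ 110)%Z 0 0 (dvd1z _); rewrite mulr0 addr0 expr1 => h.
  by apply: contraNN l_notin => n0; rewrite -dvd11_trib //; move: h; rewrite rpredBl.
rewrite padic_val_int ifN; last by apply: contraNneq n0 => ->; rewrite dvdz0.
by rewrite logn_coprime // prime_coprime.
Qed.
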